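(* In the setting of the context, let $S:\mathcal F\to\mathcal G$ be linear, let $\tau>\tau_{\min}$, and let $s$ be some positive number. Suppose that: (i) there is $f_0\in\mathcal F$ with $|f_0|_{\widetilde{\mathcal F}}=1$ and $|f_0|_{\mathcal F}\le\tau_{\min}|f_0|_{\widetilde{\mathcal F}}=\tau_{\min}<\tau$; (ii) there are $\mathcal J\subseteq\mathbb N_0$ and a non-increasing function $g:\mathcal J\to(0,\infty)$ with $\inf_{n\in\mathcal J}g(n)=0$ such that for every $n\in\mathcal J$, every $m$, and every $\boldsymbol L=(L_1,\dots,L_m)\in\Lambda^m$ with $\$(\boldsymbol L)\le n$, there is $f_1\in\mathcal F$ (depending on $n$ and the $L_i$) with $$\tau_{\min}|f_1|_{\widetilde{\mathcal F}}\le|f_1|_{\mathcal F}\le1,\qquad \boldsymbol L(f_1)=\boldsymbol 0,\qquad \|S(f_1)\|_{\mathcal G}\ge g(n).$$ Then the complexity of the problem for the cone of input functions $\mathcal C_\tau$ is bounded below, for every $\varepsilon>0$, by $$\operatorname{comp}\bigl(\varepsilon,\mathcal A(\mathcal C_\tau,\mathcal G,S,\Lambda),\mathcal B_s\bigr)\ \ge\ g^{-1}\!\left(\frac{2\tau\varepsilon}{s(\tau-\tau_{\min})}\right),$$ where $g^{-1}(\eta)=\max\{n\in\mathcal J:g(n)>\eta\}+1$, with the maximum of the empty set taken to be $-1$.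
   Context: $\mathcal F$ is a linear space of input functions with semi-norms $|\cdot|_{\mathcal F}$ and $|\cdot|_{\widetilde{\mathcal F}}$; $\tau_{\min}>0$ satisfies $\tau_{\min}|f|_{\widetilde{\mathcal F}}\le|f|_{\mathcal F}$ for all $f\in\mathcal F$. $\mathcal G$ is a linear space of outputs with norm $\|\cdot\|_{\mathcal G}$, and $S:\mathcal F\to\mathcal G$ is the solution operator. $\mathcal C_\tau=\{f\in\mathcal F:|f|_{\mathcal F}\le\tau|f|_{\widetilde{\mathcal F}}\}$ and $\mathcal B_s=\{f\in\mathcal F:|f|_{\mathcal F}\le s\}$. $\Lambda$ is a set of real-valued homogeneous functions on $\mathcal F$, i.e. $L(cf)=cL(f)$ for all $f\in\mathcal F$, $c\in\mathbb R$, $L\in\Lambda$. Each $L\in\Lambda$ has a cost $\$(L)\in\mathbb N$, and $\$(\boldsymbol L)=\$(L_1)+\dots+\$(L_m)$ for $\boldsymbol L=(L_1,\dots,L_m)$; $\boldsymbol L(f)=(L_1(f),\dots,L_m(f))$. For $\mathcal N\subseteq\mathcal F$, $\mathcal A(\mathcal N,\mathcal G,S,\Lambda)$ is the set of deterministic (possibly adaptive) algorithms $A:\mathcal N\times(0,\infty)\to\mathcal G$ of the form $A(f,\varepsilon)=\phi(L_1(f),\dots,L_m(f))$ with $L_i\in\Lambda$, where $m$ may depend on $\varepsilon$ and the values $L_i(f)$, and each $L_i$ may depend on $L_1(f),\dots,L_{i-1}(f)$. $\operatorname{cost}(A,f,\varepsilon)=\$(\boldsymbol L)\in\mathbb N_0$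 for the data $\boldsymbol L$ used on input $(f,\varepsilon)$. $\operatorname{maxcost}(A,\mathcal N,\varepsilon,\mathcal B_s)=\sup\{\operatorname{cost}(A,f,\varepsilon):f\in\mathcal N\cap\mathcal B_s\}$, and $$\operatorname{comp}(\varepsilon,\mathcal A(\mathcal N,\mathcal G,S,\Lambda),\mathcal B_s)=\inf\bigl\{\operatorname{maxcost}(A,\mathcal N,\varepsilon,\mathcal B_s):A\in\mathcal A(\mathcal N,\mathcal G,S,\Lambda),\ \|S(f)-A(f,\varepsilon')\|_{\mathcal G}\le\varepsilon'\ \forall f\in\mathcal N,\ \varepsilon'>0\bigr\},$$ with the infimum of the empty set equal to $\infty$.
   Formalization: Every L in Λ is additionally assumed additive (so Λ consists of linear functionals); with mere homogeneity L(cf)=cL(f) the claimed bound is false. *)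

(* Defs.v *)
From HB Require Import structures.
From mathcomp Require Export all_boot all_order all_algebra.
From mathcomp Require Export boolp classical_sets reals constructive_ereal.
From mathcomp Require Export ereal topology normedtype.

Set Implicit Arguments.
Unset Strict Implicit.
Unset Printing Implicit Defensive.

Import Order.TTheory GRing.Theory Num.Theory.
Import numFieldNormedType.Exports.

Local Open Scope classical_set_scope.
Local Open Scope ring_scope.

Definition is_seminorm (R : realType) (F : lmodType R) (p : F -> R) : Prop :=
  (forall f h, p (f + h) <= p f + p h) /\
  (forall (c : R) f, p (c *: f) = `|c| * p f).

Definition cone (R : realType) (F : lmodType R) (nF nFt : F -> R) (tau : R)
  : set F := [set f | nF f <= tau * nFt f].

Definition ball_of (R : realType) (F : lmodType R) (nF : F -> R) (s : R)
  : set F := [set f | nF f <= s].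

Definition info_cost (R : realType) (F : lmodType R) (cost : (F -> R) -> nat)
  (Ls : seq (F -> R)) : nat := (\sum_(L <- Ls) cost L)%N.

Definition info (R : realType) (F : lmodType R) (Ls : seq (F -> R)) (f : F)
  : seq R := [seq L f | L <- Ls].

(* A strategy [q] maps the values observed so far either to the next functional
   to evaluate or to [None] (stop).  On [f] it evaluates exactly [Ls], in this
   order: the instance [i = size Ls] of the condition says that it stops after
   [Ls], since [onth Ls (size Ls) = None]. *)
Definition evaluates (R : realType) (F : lmodType R)
  (q : seq R -> option (F -> R)) (f : F) (Ls : seq (F -> R)) : Prop :=
  forall i, (i <= size Ls)%N -> q (info (take i Ls) f) = onth Ls i.

(* The tolerance is an input of the algorithm, so the strategy and the final
   map [alg_out] (the map phi) may depend on it.  [algP] makes every run on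
   [N * (0, +oo)] finite, and determines [alg_data] uniquely there. *)
Record algorithm (R : realType) (F : lmodType R) (G : normedModType R)
    (N : set F) (Lambda : set (F -> R)) := Algorithm {
  alg_query : R -> seq R -> option (F -> R);
  alg_out : R -> seq R -> G;
  alg_data : F -> R -> seq (F -> R);
  alg_queryP : forall e y L, alg_query e y = Some L -> Lambda L;
  algP : forall f e, N f -> 0 < e ->
    evaluates (alg_query e) f (alg_data f e) }.

Section Complexity.
Variables (R : realType) (F : lmodType R) (G : normedModType R).
Variables (N : set F) (Lambda : set (F -> R)).
Implicit Types A : algorithm G N Lambda.

Definition alg_val A (f : F) (e : R) : G := alg_out A e (info (alg_data A f e) f).

Definition alg_cost (cost : (F -> R) -> nat) A (f : F) (e : R) : nat :=
  info_cost cost (alg_data A f e).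

(* [N `&` B] is meant to be non-empty: [ereal_sup set0 = -oo]. *)
Definition maxcost (cost : (F -> R) -> nat) A (e : R) (B : set F) : \bar R :=
  ereal_sup [set ((alg_cost cost A f e)%:R)%:E | f in N `&` B].

Definition successful (S : F -> G) A : Prop :=
  forall f e, N f -> 0 < e -> `|S f - alg_val A f e| <= e.

(* [ereal_inf set0 = +oo]. *)
Definition comp (cost : (F -> R) -> nat) (S : F -> G) (e : R) (B : set F)
  : \bar R :=
  ereal_inf [set maxcost cost A e B | A in [set A | successful S A]].

End Complexity.

Arguments comp {R F G} N Lambda cost S e B.

(* [A `&` ubound A] is the set of maxima of [A]; the default value -1 is the
   convention for the maximum of the empty set. *)
Definition max_int (A : set int) : int := xget (-1) (A `&` ubound A).

Definition ginv (R : realType) (J : set nat) (g : nat -> R) (eta : R) : int :=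
  max_int [set n%:Z | n in [set n | J n /\ eta < g n]] + 1.

(* Main.v *)
(* Run the algorithm on f = c0 f0 with c0 = s / tau_min, which lies in the ball.
   If the cost were at most some n with g(n) > eta, condition (ii) would give f1
   invisible to the functionals used on f, so that f + c1 f1 and f - c1 f1 produce
   the same data and hence the same output.  For c1 = s (tau - tau_min) / (2 tau)
   both lie in the cone, while their solutions are at distance
   2 c1 |S f1| >= 2 c1 g(n) > 2 eps, contradicting success at tolerance eps. *)
Require Import Defs.
From mathcomp Require Import lra ring.

Set Implicit Arguments.
Unset Strict Implicit.
Unset Printing Implicit Defensive.

Import Order.TTheory GRing.Theory Num.Theory.
Import numFieldNormedType.Exports.

Local Open Scope classical_set_scope.
Local Open Scope ring_scope.

Section Evaluates.
Variables (R : realType) (F : lmodType R).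
Implicit Types (q : seq R -> option (F -> R)) (Ls : seq (F -> R)).

Lemma evaluates_range q f Ls (Lambda : set (F -> R)) :
  (forall y L, q y = Some L -> Lambda L) -> evaluates q f Ls ->
  forall i, Lambda (tnth (in_tuple Ls) i).
Proof.
move=> qP ev i; apply: (qP (info (take i Ls) f)).
rewrite ev ?(ltnW (ltn_ord i))// (tnth_nth (fun=> 0)) /=.
by rewrite onthE (nth_map (fun=> 0)).
Qed.

Lemma evaluates_info q f h Ls :
  info Ls f = info Ls h -> evaluates q f Ls -> evaluates q h Ls.
Proof.
by move=> e ev i ile; rewrite -ev// /info !map_take -/(info _ _) -e.
Qed.

(** Induction on [i]: equal prefixes yield equal observed values, hence the same answer of [q].
    Comparing the answers through [onth] also shows that the second run has not stopped yet. *)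
Lemma evaluates_take q f Ls Ls' : evaluates q f Ls -> evaluates q f Ls' ->
  forall i, (i <= size Ls)%N -> (i <= size Ls')%N /\ take i Ls = take i Ls'.
Proof.
move=> ev ev'; elim=> [|i IH] ilt; first by rewrite !take0.
have [ile' eqt] := IH (ltnW ilt).
have eqo : onth Ls i = onth Ls' i by rewrite -ev ?(ltnW ilt)// eqt ev'.
have ilt' : (i < size Ls')%N by rewrite -onthTE -eqo onthTE.
split=> //; rewrite (take_nth (fun=> 0) ilt) (take_nth (fun=> 0) ilt') eqt.
by rewrite -!odflt_onth eqo.
Qed.

Lemma evaluates_inj q f Ls Ls' :
  evaluates q f Ls -> evaluates q f Ls' -> Ls = Ls'.
Proof.
move=> ev ev'; have [le e] := evaluates_take ev ev' (leqnn _).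
have [le' _] := evaluates_take ev' ev (leqnn _).
by rewrite -(take_size Ls) e take_oversize.
Qed.

(** The strategy sees only values, so the run on [f] is also a valid run on [h]; uniqueness of runs
    makes it the run on [h]. *)
Lemma alg_val_info (G : normedModType R) (N : set F) (Lambda : set (F -> R))
    (A : algorithm G N Lambda) f h e : N f -> N h -> 0 < e ->
  info (alg_data A f e) f = info (alg_data A f e) h ->
  alg_val A h e = alg_val A f e.
Proof.
move=> Nf Nh e0 efh; rewrite /alg_val efh.
by rewrite (evaluates_inj (algP Nh e0) (evaluates_info efh (algP Nf e0))).
Qed.

(** Adding [h] raises [nF] by at most [nF h] and lowers [nFt] by at most [nFt h <= nF h / tau_min];
    the bound says that the slack of [f] in the cone condition, scaled by [tau_min], absorbs
    both. *)
Lemma cone_add (nF nFt : F -> R) (tau_min tau : R) f h :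
  is_seminorm nF -> is_seminorm nFt -> 0 <= tau ->
  0 < tau_min -> (forall f, tau_min * nFt f <= nF f) ->
  (tau + tau_min) * nF h <= tau_min * (tau * nFt f - nF f) ->
  cone nF nFt tau (f + h).
Proof.
move=> [nFD nFZ] [nFtD nFtZ] tau0 tm0 tmP bnd; rewrite /cone /=.
have nFtN : nFt (- h) = nFt h by rewrite -scaleN1r nFtZ normrN1 mul1r.
have := nFtD (f + h) (- h); rewrite addrK nFtN => le_f.
rewrite -(ler_pM2l tm0).
have /(ler_wpM2l (ltW tm0)) := nFD f h.
have /(ler_wpM2l tau0) := tmP h.
have /(ler_wpM2l (mulr_ge0 (ltW tm0) tau0)) := le_f.
lra.
Qed.

End Evaluates.

Lemma ginv_le (R : realType) (J : set nat) (g : nat -> R) (eta : R) (c : nat) :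
  (forall n, J n -> eta < g n -> (n < c)%N) -> (ginv J g eta <= c%:Z).
Proof.
move=> H; rewrite /ginv /max_int; case: xgetP => [_ -> [[n [Jn gn] <-] _]|_].
  by rewrite -PoszD lez_nat addn1 H.
(* Without a maximum the default -1 gives [ginv = 0]. *)
by rewrite addNr.
Qed.

(* [Lambda_add] is not in the source, which only asks the functionals to be
   homogeneous; without it the statement is false. *)
Theorem theorem6 (R : realType) (F : lmodType R) (G : normedModType R)
  (nF nFt : F -> R) (nF_semi : is_seminorm nF) (nFt_semi : is_seminorm nFt)
  (tau_min : R) (tau_min_gt0 : 0 < tau_min)
  (tau_minP : forall f, tau_min * nFt f <= nF f)
  (Lambda : set (F -> R))
  (Lambda_homog : forall L, Lambda L -> forall (c : R) f, L (c *: f) = c * L f)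
  (Lambda_add : forall L, Lambda L -> forall f h, L (f + h) = L f + L h)
  (cost : (F -> R) -> nat) (cost_gt0 : forall L, Lambda L -> (0 < cost L)%N)
  (S : {linear F -> G}) (tau : R) (tau_gt : tau_min < tau)
  (s : R) (s_gt0 : 0 < s)
  (cond_i : exists f0 : F, nFt f0 = 1 /\ nF f0 <= tau_min * nFt f0)
  (J : set nat) (g : nat -> R)
  (g_gt0 : forall n, J n -> 0 < g n)
  (g_noninc : forall m n, J m -> J n -> (m <= n)%N -> g n <= g m)
  (g_inf : ereal_inf [set (g n)%:E | n in J] = 0%:E)
  (cond_ii : forall n, J n -> forall m (L : m.-tuple (F -> R)),
    (forall i, Lambda (tnth L i)) -> (info_cost cost L <= n)%N ->
    exists f1 : F, [/\ tau_min * nFt f1 <= nF f1, nF f1 <= 1,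
      forall i, tnth L i f1 = 0 & g n <= `|S f1|])
  (eps : R) (eps_gt0 : 0 < eps) :
  (((ginv J g (2 * tau * eps / (s * (tau - tau_min))))%:~R)%:E
    <= comp (cone nF nFt tau) Lambda cost S eps (ball_of nF s))%E.
Proof.
apply: le_ereal_inf_tmp => _ [A succA <-].
have [f0 [nFtf0 nFf0]] := cond_i; rewrite nFtf0 mulr1 in nFf0.
have tau_gt0 : 0 < tau by lra.
have dtau_gt0 : 0 < tau - tau_min by lra.
have [_ nFZ] := nF_semi; have [_ nFtZ] := nFt_semi.
pose c0 := s / tau_min; have c0_gt0 : 0 < c0 by rewrite divr_gt0.
have c0E : c0 * tau_min = s by rewrite divfK ?gt_eqF.
pose f := c0 *: f0.
have nFf : nF f <= s.
  by rewrite nFZ gtr0_norm// -c0E ler_wpM2l// ltW.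
have nFtf : nFt f = c0 by rewrite nFtZ nFtf0 mulr1 gtr0_norm.
have coneD h : (tau + tau_min) * nF h <= s * (tau - tau_min) ->
    cone nF nFt tau (f + h).
  move=> hP; apply: (@cone_add _ _ _ _ tau_min) => //; first exact: ltW.
  apply: (le_trans hP); rewrite nFtf.
  (* As [nF f <= s], this slack is at least [s * (tau - tau_min)]. *)
  have -> : tau_min * (tau * c0 - nF f) = tau * s - tau_min * nF f.
    by rewrite -c0E; ring.
  by have := ler_wpM2l (ltW tau_min_gt0) nFf; lra.
have conef : cone nF nFt tau f.
  rewrite -[f]addr0; apply: coneD.
  by rewrite -(scale0r f0) nFZ normr0 mul0r mulr0 mulr_ge0// ltW.
apply: (@le_trans _ _ ((alg_cost cost A f eps)%:R)%:E); last first.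
  by apply: ereal_sup_ubound; exists f.
rewrite lee_fin (pmulrn 1 (alg_cost _ _ _ _)) ler_int; apply: ginv_le => n Jn gn.
rewrite ltnNge; apply/negP => cost_le.
have LsP := evaluates_range (@alg_queryP _ _ _ _ _ A eps) (algP conef eps_gt0).
have [f1 [_ nFf1 Lf1 gf1]] := cond_ii n Jn _ (in_tuple _) LsP cost_le.
pose c1 := s * (tau - tau_min) / (2 * tau).
have c1_gt0 : 0 < c1 by rewrite divr_gt0 ?mulr_gt0.
have c1E : 2 * c1 * tau = s * (tau - tau_min).
  by rewrite /c1; field; rewrite gt_eqF.
have fool c : `|c| = c1 ->
    cone nF nFt tau (f + c *: f1) /\
    alg_val A (f + c *: f1) eps = alg_val A f eps.
  move=> cE; have conec : cone nF nFt tau (f + c *: f1).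
    apply: coneD; rewrite nFZ cE -c1E.
    (* The factor [2 * tau] in [c1] comes from [tau + tau_min <= 2 * tau]. *)
    have : (tau + tau_min) * (c1 * nF f1) <= (tau + tau_min) * c1.
      apply: ler_wpM2l; first by rewrite addr_ge0// ltW.
      by rewrite ler_piMr// ltW.
    by have := ltW (mulr_gt0 c1_gt0 dtau_gt0); lra.
  split=> //; apply: alg_val_info => //.
  apply: (@eq_from_nth _ 0); rewrite ?size_map// => i isz.
  have := Lf1 (Ordinal isz); have := LsP (Ordinal isz).
  rewrite (tnth_nth (fun=> 0)) /= => LL L0.
  rewrite !(nth_map (fun=> 0))// Lambda_add// (Lambda_homog _ LL c).
  by rewrite L0 mulr0 addr0.
have [cone1 val1] := fool c1 (gtr0_norm c1_gt0).
have [cone2 val2] : _ /\ _ := fool (- c1) (etrans (normrN _) (gtr0_norm c1_gt0)).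
(* Success is required on the whole cone, so the two perturbed inputs need not lie in the ball. *)
have := succA _ _ cone1 eps_gt0; have := succA _ _ cone2 eps_gt0.
rewrite {}val1 {}val2 distrC => le2 le1.
have le12 := le_trans (ler_distD _ _ _) (lerD le1 le2).
have : `|S (f + c1 *: f1) - S (f + (- c1) *: f1)| = 2 * c1 * `|S f1|.
  rewrite -linearB opprD addrACA subrr add0r scaleNr opprK -scalerDl linearZ.
  by rewrite normrZ gtr0_norm ?addr_gt0// mulr_natl mulr2n.
move=> distE; rewrite {}distE in le12.
(* By [c1E], [gn] becomes [eps < c1 * g n] up to the factor [2 * tau]. *)
move: gn; rewrite ltr_pdivrMr ?(mulr_gt0 s_gt0)// -c1E.
have /(ler_wpM2l (ltW (mulr_gt0 c1_gt0 tau_gt0))) := gf1.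
have /(ler_wpM2l (ltW tau_gt0)) := le12.
lra.
Qed.
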